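(* Suppose that for each $i=1,2,\ldots,p$ the function $x\mapsto f(x,\zeta_i)$ is coercive on $\mathbb{R}^n$. Then the GOWA robust objective function $$\phi(x)=\left(\sum_{i=1}^{p}w_i\,(s_i(x))^{\lambda}\right)^{1/\lambda},\qquad x\in\mathbb{R}^n,$$ is coercive on $\mathbb{R}^n$.
   Context: Setting: $\Omega=\{\zeta_1,\ldots,\zeta_p\}\subseteq\mathbb{R}^m$ is a finite (ordered) uncertainty set, the feasible set is $\mathcal{X}=\mathbb{R}^n$, and $f:\mathbb{R}^n\times\Omega\to\mathbb{R}$ satisfies $f(x,\zeta)\ge 0$ for all $x\in\mathbb{R}^n$, $\zeta\in\Omega$. Auxiliary functions $s_1,\ldots,s_p:\mathbb{R}^n\to\mathbb{R}$: for each $x$, recursively for $i=1,\ldots,p$, let $j_i(x)$ be the smallest index among those $j\in\{1,\ldots,p\}\setminus\{j_1(x),\ldots,j_{i-1}(x)\}$ at which $f(x,\zeta_j)$ is maximal over that remaining index set, and put $s_i(x)=f(x,\zeta_{j_i(x)})$. Thus exactly one index is removed at each step, so $s_i(x)$ is the $i$-th largest of the values $f(x,\zeta_1),\ldots,f(x,\zeta_p)$ counted with multiplicity. Parameters: a real $\lambda>0$ and weights $w_i\ge 0$, $i=1,\ldots,p$, with $\sum_{i=1}^p w_i=1$, all given. A function $g:\mathbb{R}^n\to\mathbb{R}$ is coercive if $g(x)\to+\infty$ as $\|x\|\to\infty$. *)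

(* Defs.v *)
From HB Require Import structures.
From mathcomp Require Import all_boot all_order all_algebra.
From mathcomp Require Import all_classical all_reals all_analysis.

Set Implicit Arguments.
Unset Strict Implicit.
Unset Printing Implicit Defensive.

Import Order.TTheory GRing.Theory Num.Theory.
Import numFieldNormedType.Exports.

Local Open Scope classical_set_scope.
Local Open Scope ring_scope.

(* The library norm on row vectors is the max norm, hence this definition. *)
Definition eucl_norm (R : realType) (n : nat) (x : 'rV[R]_n) : R :=
  Num.sqrt (\sum_(k < n) x 0 k ^+ 2).

Definition eucl_infty (R : realType) (n : nat) : set_system 'rV[R]_n :=
  filter_from [set: R] (fun r => [set x | r < eucl_norm x]).

Definition coercive (R : realType) (n : nat) (g : 'rV[R]_n -> R) : Prop :=
  g x @[x --> @eucl_infty R n] --> +oo.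

(* For n = 0 the filter is not proper and every function is coercive. *)
Lemma coerciveP (R : realType) (n : nat) (g : 'rV[R]_n -> R) :
  coercive g <->
  forall M : R, exists r : R, forall x, r < eucl_norm x -> M < g x.
Proof.
split=> [cg M | cg A [M [_ MA]]].
  have [] := cg [set y | M < y].
    by exists M; split; [exact: num_real | move=> y].
  by move=> r _ rP; exists r => x /rP.
have [r rP] := cg M; exists r => // x /= /rP Mg.
exact: MA.
Qed.

Section Ordering.
Variables (R : realType) (p : nat).
Implicit Types (v : 'I_p -> R) (A : {set 'I_p}).

Definition is_first_argmax v A (j : 'I_p) : bool :=
  [&& j \in A, [forall k in A, v k <= v j]
    & [forall k in A, (v k == v j) ==> (j <= k)%N]].

(* The default [d] is only returned when [A] is empty, which does not happen
   below: see [sel_indexP]. *)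
Definition first_argmax (d : 'I_p) v A : 'I_p :=
  odflt d [pick j | is_first_argmax v A j].

(* [remaining d v i] is the set of indices left after [i] removals.  Indices
   are 0-based, so the index j_(i+1) of the recursion is [sel_index v i]. *)
Fixpoint remaining (d : 'I_p) v (i : nat) : {set 'I_p} :=
  if i is i'.+1 then
    remaining d v i' :\ first_argmax d v (remaining d v i')
  else [set: 'I_p]%SET.

Definition sel_index v (i : 'I_p) : 'I_p := first_argmax i v (remaining i v i).

Lemma first_argmaxP d v A :
  A != finset.set0 -> is_first_argmax v A (first_argmax d v A).
Proof.
case/set0Pn => a aA; rewrite /first_argmax; case: pickP => [//|noj].
have [j jA jmax] : exists2 j, j \in A & forall k, k \in A -> v k <= v j.
  case: (Order.TotalTheory.arg_maxP v aA) => j jA jmax.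
  by exists j => // k kA; exact: jmax.
pose P := [pred k | (k \in A) && (v k == v j)].
have Pj : P j by rewrite /= jA eqxx.
case: (arg_minnP (fun k : 'I_p => k : nat) Pj) => l /andP[lA /eqP vl] lmin.
have := noj l; rewrite /is_first_argmax lA /= => /negP[].
apply/andP; split; apply/forall_inP => k kA; first by rewrite vl jmax.
by apply/implyP; rewrite vl => vk; apply: lmin; rewrite /= kA.
Qed.

Lemma card_remaining d v i : (i <= p)%N -> #|remaining d v i| = (p - i)%N.
Proof.
elim: i => [|i IH] ip /=; first by rewrite cardsT card_ord subn0.
have ci := IH (ltnW ip).
have ne : remaining d v i != finset.set0 by rewrite -card_gt0 ci subn_gt0.
have /and3P[jA _ _] := first_argmaxP d v ne.
have := cardsD1 (first_argmax d v (remaining d v i)) (remaining d v i).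
by rewrite jA ci add1n subnS => ->.
Qed.

Lemma remaining_neq0 d v i : (i < p)%N -> remaining d v i != finset.set0.
Proof. by move=> ip; rewrite -card_gt0 card_remaining ?subn_gt0 // ltnW. Qed.

Lemma remaining_default d d' v i :
  (i <= p)%N -> remaining d v i = remaining d' v i.
Proof.
elim: i => [//|i IH] ip /=; rewrite -IH ?(ltnW ip)//; congr (_ :\ _).
have := first_argmaxP d v (remaining_neq0 d v ip).
by rewrite /first_argmax; case: pickP => // noj; rewrite noj.
Qed.

Lemma in_remaining d v i k : (i <= p)%N ->
  (k \in remaining d v i) = [forall l : 'I_p, (l < i)%N ==> (k != sel_index v l)].
Proof.
elim: i => [|i IH] ip /=; first by rewrite finset.in_setT; apply/esym/forallP.
have e : first_argmax d v (remaining d v i) = sel_index v (Ordinal ip).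
  rewrite /sel_index (remaining_default (Ordinal ip) d) 1?ltnW //=.
  have := first_argmaxP d v (remaining_neq0 d v ip).
  by rewrite /first_argmax; case: pickP => // noj; rewrite noj.
rewrite e in_setD1 IH 1?ltnW//; apply/andP/forallP => [[ki /forallP H] l|H].
  apply/implyP; rewrite ltnS leq_eqVlt => /orP[/eqP li|li].
    by rewrite (_ : l = Ordinal ip) //; apply: val_inj.
  by have /implyP := H l; exact.
split; first by have /implyP := H (Ordinal ip); apply => /=.
by apply/forallP => l; apply/implyP => li; have /implyP := H l; apply; rewrite ltnW.
Qed.

Lemma sel_indexP v (i : 'I_p) :
  is_first_argmax v
    [set k | [forall l : 'I_p, (l < i)%N ==> (k != sel_index v l)]]%SET
    (sel_index v i).
Proof.
rewrite (_ : finset _ = remaining i v i).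
  exact/first_argmaxP/remaining_neq0.
by apply/setP => k; rewrite inE in_remaining // ltnW.
Qed.

End Ordering.

Section Gowa.
Variables (R : realType) (m n p : nat) (Omega : set 'rV[R]_m).
Variables (zeta : 'I_p -> Omega) (f : 'rV[R]_n -> Omega -> R).

Definition sorted_value (i : 'I_p) (x : 'rV[R]_n) : R :=
  f x (zeta (sel_index (fun j => f x (zeta j)) i)).

Definition gowa_objective (lambda : R) (w : 'I_p -> R) (x : 'rV[R]_n) : R :=
  (\sum_(i < p) w i * sorted_value i x `^ lambda) `^ lambda^-1.

End Gowa.

(* Main.v *)
Require Import Defs.
From HB Require Import structures.
From mathcomp Require Import all_boot all_order all_algebra.
From mathcomp Require Import all_classical all_reals all_analysis.
Import Order.TTheory GRing.Theory Num.Theory.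
Import numFieldNormedType.Exports.
Local Open Scope classical_set_scope.
Local Open Scope ring_scope.

(** Each sorted value [s_i(x)] is one of the scenario values [f(x, zeta_j)],
    and a weighted power mean of nonnegative numbers is at least the smallest
    of them.  So the objective dominates [min_j f(x, zeta_j)] whatever the
    weights are, and a minimum of finitely many coercive functions is coercive
    ([coercive_uniform]).  The ordering matters only through the choice of a
    scenario index at each rank, which may change with [x]; this is why the
    lower bound is made uniform in the scenario before it is passed to the
    mean ([le_power_mean]). *)

(** Finiteness of the family is what makes this work: the maximum of the
    individual radii serves all members at once. *)
Lemma coercive_uniform (R : realType) (n : nat) (I : finType)
    (g : I -> 'rV[R]_n -> R) :
    (forall i, coercive (g i)) ->
  forall M : R, exists r : R, forall x, r < eucl_norm x -> forall i, M < g i x.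
Proof.
move=> g_coercive M.
have /choice[r rP] : forall i, exists r, forall x, r < eucl_norm x -> M < g i x.
  by move=> i; have /coerciveP := g_coercive i; exact.
exists (\big[Order.max/0]_i r i) => x rx i; apply: rP.
by apply: le_lt_trans rx; exact: le_bigmax.
Qed.

(** The constant [K] is its own power mean since the weights sum to 1, and
    power means are monotone on nonnegative arguments. *)
Lemma le_power_mean (R : realType) (I : finType) (lambda : R) (w a : I -> R)
    (K : R) :
    0 < lambda -> (forall i, 0 <= w i) -> \sum_i w i = 1 ->
    0 <= K -> (forall i, K <= a i) ->
  K <= (\sum_i w i * a i `^ lambda) `^ lambda^-1.
Proof.
move=> lambda_gt0 w_ge0 w_sum K_ge0 Ka.
have -> : K = (K `^ lambda) `^ lambda^-1.
  by rewrite -powRrM divff ?powRr1 // gt_eqF.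
apply: ge0_ler_powR; rewrite ?nnegrE ?invr_ge0 ?powR_ge0 //; first exact: ltW.
  by apply: sumr_ge0 => i _; rewrite mulr_ge0 ?powR_ge0.
rewrite -[leLHS]mul1r -w_sum mulr_suml; apply: ler_sum => i _.
apply: ler_wpM2l => //.
by apply: ge0_ler_powR; rewrite ?nnegrE ?(le_trans K_ge0 (Ka i)) // ltW.
Qed.

Theorem theorem3p9 (R : realType) (m n p : nat) (Omega : set 'rV[R]_m)
    (zeta : 'I_p -> Omega) (Omega_zeta : range zeta = [set: Omega])
    (f : 'rV[R]_n -> Omega -> R)
    (f_ge0 : forall (x : 'rV[R]_n) (z : Omega), 0 <= f x z)
    (lambda : R) (lambda_gt0 : 0 < lambda)
    (w : 'I_p -> R) (w_ge0 : forall i : 'I_p, 0 <= w i)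
    (w_sum : \sum_(i < p) w i = 1)
    (f_coercive : forall i : 'I_p, coercive (fun x : 'rV[R]_n => f x (zeta i))) :
  coercive (gowa_objective zeta f lambda w).
Proof.
apply/coerciveP => M.
(* The mean only inherits a non-strict bound, by a nonnegative number; [K] is
   therefore taken nonnegative and strictly above [M]. *)
pose K := `|M| + 1.
have [r rP] := coercive_uniform _ _ _ _ f_coercive K.
exists r => x /rP Kf; apply: (@lt_le_trans _ _ K).
  by rewrite (le_lt_trans (ler_norm M)) // ltrDl.
apply: le_power_mean => //; first by rewrite addr_ge0.
by move=> i; exact/ltW/Kf.
Qed.
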